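(* Let $m\ge 3$ be an odd integer, $M=\mathrm{diag}(2,m)$, and let $q,n\in\mathbb{N}$ (both $\ge1$) with $n\ge q$. Let $a_{M,n}(z_1,z_2)$ be the symbol of the anisotropic interpolatory subdivision scheme of order $n$ and dilation matrix $M$, and put $\hat a(\mathbf{x})=a_{M,n}(e^{-\mathrm{i}x_1},e^{-\mathrm{i}x_2})$ for $\mathbf{x}=(x_1,x_2)\in\mathbb{R}^2$. Then (i) for every $\mathbf{y}=(y_1,y_2)\neq(0,0)$ with $y_1\in\{0,\frac12\}$ and $y_2\in\{0,\frac1m,\dots,\frac{m-1}{m}\}$, $$\limsup_{\mathbf{x}\in\mathbb{R}^2,\ \|\mathbf{x}\|\to0}\frac{|\hat a(\mathbf{x}+2\pi\mathbf{y})|}{\|\mathbf{x}\|^{2q}}<\infty;$$ (ii) $$\limsup_{\mathbf{x}\in\mathbb{R}^2,\ \|\mathbf{x}\|\to0}\frac{|\hat a(\mathbf{x})-2m|}{\|\mathbf{x}\|}<\infty.$$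
   Context: For integers $r\ge2$ and $k\ge1$, the symbol of the univariate $(2k)$-point Dubuc–Deslauriers interpolatory subdivision scheme of dilation $r$ is the Laurent polynomial $$a_{r,k}(z)=1+\sum_{\varepsilon=1}^{r-1}\sum_{\beta=-k+1}^{k}\frac{(-1)^{\beta+k}}{(2k-1)!\,(\varepsilon/r-\beta)}\binom{2k-1}{k-\beta}\Bigl(-k+1-\frac{\varepsilon}{r}\Bigr)_{2k}\,z^{-r\beta+\varepsilon},\qquad z\in\mathbb{C}\setminus\{0\},$$ where $(x)_0=1$ and $(x)_\ell=x(x+1)\cdots(x+\ell-1)$ is the Pochhammer symbol. The anisotropic interpolatory subdivision scheme of order $n$ and dilation matrix $M=\mathrm{diag}(2,m)$ is defined by its symbol $$a_{M,n}(z_1,z_2)=\sum_{k=0}^{n-1}a_{2,n-k}(z_1)\,a_{m,k+1}(z_2)-\sum_{k=0}^{n-2}a_{2,n-k-1}(z_1)\,a_{m,k+1}(z_2),\qquad (z_1,z_2)\in(\mathbb{C}\setminus\{0\})^2$$ (the second sum is empty for $n=1$). Limits superior are taken over $\mathbf{x}\neq\mathbf{0}$. *)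

(* Defs.v *)
From HB Require Import structures.
From mathcomp Require Import all_boot all_order all_algebra.
From mathcomp Require Import complex.
From mathcomp Require Import all_classical all_reals all_analysis.

Set Implicit Arguments.
Unset Strict Implicit.
Unset Printing Implicit Defensive.

Import Order.TTheory GRing.Theory Num.Theory.
Import numFieldNormedType.Exports.

Local Open Scope ring_scope.
Local Open Scope complex_scope.

Definition pochhammer (R : realType) (x : R) (l : nat) : R :=
  \prod_(j < l) (x + j%:R).

Definition dd_coef (R : realType) (r k e : nat) (beta : int) : R :=
  (-1) ^ (beta + k%:Z)
    / (((2 * k - 1)`!)%:R * (e%:R / r%:R - beta%:~R))
  * 'C(2 * k - 1, `|k%:Z - beta|)%:R
  * pochhammer (- k%:R + 1 - e%:R / r%:R) (2 * k).

(* The inner sum ranges over -k+1 <= beta <= k, as beta = b - k + 1 with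
   0 <= b < 2k. On this range k - beta >= 0, so that the absolute value in
   dd_coef is only a conversion to nat. Powers are integer powers, so the
   function is the intended Laurent polynomial for z != 0 only. *)
Definition dd_symbol (R : realType) (r k : nat) (z : R[i]) : R[i] :=
  1 + \sum_(1 <= e < r) \sum_(b < 2 * k)
        let beta : int := b%:Z - k%:Z + 1 in
        (dd_coef R r k e beta)%:C * z ^ (- r%:Z * beta + e%:Z).

Definition aniso_symbol (R : realType) (m n : nat) (z1 z2 : R[i]) : R[i] :=
  \sum_(0 <= k < n) dd_symbol 2 (n - k) z1 * dd_symbol m k.+1 z2
  - \sum_(0 <= k < n.-1) dd_symbol 2 (n - k - 1) z1 * dd_symbol m k.+1 z2.

Definition cexp (R : realType) (z : R[i]) : R[i] :=
  (expR (complex.Re z))%:C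
  * (cos (complex.Im z) +i* sin (complex.Im z)).

Definition aniso_hat (R : realType) (m n : nat) (x : R * R) : R[i] :=
  aniso_symbol m n (cexp (- ('i%C * x.1%:C))) (cexp (- ('i%C * x.2%:C))).

Definition cmodulus (R : realType) (z : R[i]) : R := complex.Re `|z|.

(* The library norm on R * R is the sup norm. *)
Definition enorm (R : realType) (x : R * R) : R :=
  Num.sqrt (x.1 ^+ 2 + x.2 ^+ 2).

Definition limsup_at0 (R : realType) (f : R * R -> R) : \bar R :=
  limf_esup (fun x : R * R => (f x)%:E) (dnbhs (0 : R * R)).

(* Main.v *)
Require Import Defs.
From HB Require Import structures.
From mathcomp Require Import all_boot all_order all_algebra.
From mathcomp Require Import complex.
From mathcomp Require Import all_classical all_reals all_analysis.
From mathcomp Require Import ring lra zify.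

Set Implicit Arguments.
Unset Strict Implicit.
Unset Printing Implicit Defensive.

Import Order.TTheory GRing.Theory Num.Theory.
Import numFieldNormedType.Exports.

Local Open Scope ring_scope.

(** The symbol of the 2k-point scheme collects the Lagrange weights of the
    nodes -k+1, ..., k evaluated at the points e/r. Two facts drive the proof.

    - One variable. Put z = zeta * w with zeta ^+ r = 1 and `|w| = 1. Up to a
      power of w, the symbol is the sum over e < r of zeta ^+ e times a sum of
      Lagrange weights against the powers w ^+ (r * g + e), where g = k - beta.
      Expanding these powers around w = 1, the coefficient of (w - 1) ^+ i is
      a sum of the weights against 'C(r * g + e, i), which is a polynomial of
      degree i in g; for i < 2 * k Lagrange interpolation reproduces it, with
      value 'C(r * k, i) for every e. Hence each inner sum equals w ^+ (r * k)
      up to O(`|w - 1| ^+ (2 * k)), and the symbol equals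
      \sum_(e < r) zeta ^+ e up to the same error; see
      [dd_symbol_near_root_of_unity]. This geometric sum is r at zeta = 1 and
      0 at every other r-th root of unity.

    - Two variables. Write A k = alpha + a k and B k = beta + b k, where alpha
      and beta are the two geometric sums and a k, b k have order 2k at the
      point considered. The difference of sums that defines the anisotropic
      symbol telescopes ([sum_aniso_telescope]): what is left is the constant
      alpha * beta, multiples of a n and b n, and products of the form
      a i * b j with i + j >= n, all of order at least 2n. So the
      symbol is alpha * beta + O(enorm x ^+ (2 * n)) near every point of the
      grid ([order_ge_aniso_hat]), and alpha * beta is 2 * m at the origin and
      0 elsewhere. *)

(** * Reproduction of binomial coefficients by Lagrange weights *)

(** The binomial coefficient 'C(X, i) as a polynomial in X, so that
    interpolation applies to it. *)
Fixpoint binpoly (F : fieldType) (i : nat) : {poly F} :=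
  if i is j.+1 then (i%:R)^-1 *: (binpoly F j * ('X - j%:R%:P)) else 1.

Lemma size_binpoly (F : fieldType) i : (size (binpoly F i) <= i.+1)%N.
Proof.
elim: i => [|i IHi] /=; first by rewrite size_poly1.
apply: leq_trans (size_scale_leq _ _) _.
apply: leq_trans (size_polyMleq _ _) _.
by rewrite size_XsubC addn2.
Qed.

Lemma binpolyE (F : numFieldType) i n : (binpoly F i).[n%:R] = 'C(n, i)%:R.
Proof.
elim: i => [|i IHi]; first by rewrite bin0 /= hornerC.
rewrite /= hornerZ hornerM hornerXsubC IHi.
apply: (mulfI (_ : i.+1%:R != 0)); first by rewrite pnatr_eq0.
rewrite mulVKf ?pnatr_eq0 // -natrM mul_bin_left natrM mulrC.
case: (leqP i n) => [le_in|lt_ni]; first by rewrite natrB.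
by rewrite bin_small // !mulr0.
Qed.

Lemma lagrange_reproduction (F : numFieldType) N (p : {poly F}) u :
    (0 < N)%N -> (size p <= N)%N ->
  \sum_(g < N) (tnth (lagrange N (GRing.natmul 1)) g).[u] * p.[g%:R] = p.[u].
Proof.
move=> N_gt0 szp; have nat_inj : injective (GRing.natmul 1 : nat -> F).
  by move=> a b /eqP; rewrite eqr_nat => /eqP.
rewrite [p in RHS](lagrange_gen N_gt0 nat_inj szp) horner_sum.
by apply: eq_bigr => g _; rewrite hornerM hornerC mulrC.
Qed.

(** The polynomial g |-> 'C(r * g + e, i) has degree i < 2 * k, and r * u + e
    is r * k at u = k - e / r: the value is independent of e, which is what
    makes the different residues modulo r cancel at a root of unity. *)
Lemma lagrange_bin_reproduction (F : numFieldType) r k e i :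
    (0 < r)%N -> (i < 2 * k)%N ->
  \sum_(g < 2 * k)
     (tnth (lagrange (2 * k) (GRing.natmul 1)) g).[k%:R - e%:R / r%:R]
       * 'C(r * g + e, i)%:R = 'C(r * k, i)%:R :> F.
Proof.
move=> r_gt0 lt_i; pose q : {poly F} := r%:R *: 'X + e%:R%:P.
have sz_q : (size q <= 2)%N.
  apply: leq_trans (size_polyD _ _) _; rewrite geq_max.
  rewrite (leq_trans (size_scale_leq _ _)) ?size_polyX //.
  by rewrite (leq_trans (size_polyC_leq1 _)).
pose p := binpoly F i \Po q.
have pE x : p.[x] = (binpoly F i).[r%:R * x + e%:R].
  by rewrite horner_comp !hornerE.
have sz_p : (size p <= 2 * k)%N.
  apply: leq_trans (size_comp_poly_leq _ _) _.
  apply: leq_trans lt_i; rewrite ltnS.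
  apply: leq_trans (leq_mul (_ : _ <= i)%N (_ : _ <= 1)%N) _; rewrite ?muln1 //.
    by have := size_binpoly F i; case: size.
  by case: size sz_q => // -[|[]].
have := lagrange_reproduction (k%:R - e%:R / r%:R) (leq_ltn_trans (leq0n _) lt_i) sz_p.
have r_neq0 : r%:R != 0 :> F by rewrite pnatr_eq0 -lt0n.
have uE : r%:R * (k%:R - e%:R / r%:R) + e%:R = (r * k)%:R :> F.
  by rewrite natrM; field.
rewrite pE uE binpolyE => <-; apply: eq_bigr => g _.
by rewrite pE -natrM -natrD binpolyE.
Qed.

(** * Estimate on the unit circle from binomial moments *)

(** The number of terms S is free, so that powers with different exponents can
    be expanded over a common range. *)
Lemma exp_binomial_at1 (F : comNzRingType) (w : F) p S : (p < S)%N ->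
  w ^+ p = \sum_(i < S) 'C(p, i)%:R * (w - 1) ^+ i.
Proof.
move=> lt_pS; rewrite -{1}[w](addrNK 1) addrC exprDn.
under eq_bigr => i _ do rewrite expr1n mul1r -mulr_natl.
rewrite (big_ord_widen S (fun i => 'C(p, i)%:R * (w - 1) ^+ i)) // big_mkcond.
apply: eq_bigr => i _; rewrite ltnS; case: leqP => // lt_pi.
by rewrite bin_small // mul0r.
Qed.

(** The hypothesis says that the expansion in powers of w - 1 starts at degree
    d. Working with the powers of w - 1 directly gives the estimate on the
    whole circle, without derivatives. *)
Lemma unit_circle_bound_of_moments (F : numFieldType) N (c : 'I_N -> F)
    (p : 'I_N -> nat) (P d : nat) :
    (forall i, (i < d)%N -> \sum_g c g * 'C(p g, i)%:R = 'C(P, i)%:R) ->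
  exists2 K : F, 0 <= K & forall w : F, `|w| = 1 ->
    `|\sum_g c g * w ^+ p g - w ^+ P| <= K * `|w - 1| ^+ d.
Proof.
move=> moment.
pose S := (\max_g p g + P).+1.
pose D i := \sum_g c g * 'C(p g, i)%:R - 'C(P, i)%:R.
exists (\sum_(i < S) `|D i| * 2 ^+ i) => [|w w1].
  by apply: sumr_ge0 => i _; rewrite mulr_ge0 // exprn_ge0.
have -> : \sum_g c g * w ^+ p g - w ^+ P = \sum_(i < S) D i * (w - 1) ^+ i.
  rewrite (@exp_binomial_at1 _ w P S) ?ltnS ?leq_addl //.
  under eq_bigr => g _.
    rewrite (@exp_binomial_at1 _ w (p g) S); last first.
      by rewrite ltnS (leq_trans (leq_bigmax g)) ?leq_addr.
    rewrite mulr_sumr; over.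
  rewrite exchange_big -sumrB; apply: eq_bigr => i _.
  rewrite mulrBl mulr_suml; congr (_ - _).
  by apply: eq_bigr => g _; rewrite mulrA.
rewrite mulr_suml (le_trans (ler_norm_sum _ _ _)) //.
apply: ler_sum => i _; rewrite normrM normrX.
have [lt_id|le_di] := ltnP i d.
  by rewrite /D moment // subrr normr0 !mul0r.
rewrite -mulrA ler_wpM2l // -{1}(subnK le_di) exprD ler_wpM2r ?exprn_ge0 //.
(* The powers above d are absorbed in the constant since `|w - 1| <= 2. *)
have le2 : `|w - 1| <= 2.
  by rewrite (le_trans (ler_normB _ _)) // w1 normr1.
apply: le_trans (_ : 2 ^+ (i - d) <= _); first by rewrite lerXn2r ?nnegrE.
by rewrite ler_weXn2l ?ler1n // leq_subr.
Qed.

(** * The Dubuc-Deslauriers symbol near roots of unity *)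

Lemma prod_natB_fact (F : comNzRingType) n :
  \prod_(j < n) (n%:R - j%:R) = n`!%:R :> F.
Proof.
elim: n => [|n IHn]; first by rewrite big_ord0.
rewrite big_ord_recl subr0 factS natrM -IHn; congr (_ * _).
by apply: eq_bigr => j _; rewrite lift0 -!natr1; ring.
Qed.

(** The number of nodes is written g.+1 + s to induct on the number s of nodes
    above g, each of which contributes a negative factor. *)
Lemma prod_node_differences (F : comNzRingType) g s :
  \prod_(j < g.+1 + s | j != g :> nat) (g%:R - j%:R)
    = (-1) ^+ s * (g`! * s`!)%:R :> F.
Proof.
elim: s => [|s IHs].
  rewrite addn0 big_mkcond big_ord_recr /= eqxx mulr1 expr0 mul1r muln1.
  rewrite -prod_natB_fact; apply: eq_bigr => j _ /=.
  by rewrite neq_ltn ltn_ord.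
rewrite addnS big_mkcond big_ord_recr /= -big_mkcond IHs.
rewrite ifT; last by lia.
by rewrite factS exprS !natrM natrD -!natr1; ring.
Qed.

(** The node beta = k - g and the point e / r are reflected to g and k - e / r,
    which makes the nodes 0, ..., 2k-1 and all exponents r * g + e natural
    numbers. The Pochhammer symbol is then the product over all nodes, and the
    signed binomial coefficient over (2k-1)! is the inverse of the product of
    the node differences. *)
Lemma dd_coef_lagrange (R : realType) r k e (g : 'I_(2 * k)) :
    (0 < e < r)%N ->
  dd_coef R r k e (k%:Z - (g : nat)%:Z)
    = (tnth (lagrange (2 * k) (GRing.natmul 1)) g).[k%:R - e%:R / r%:R].
Proof.
move=> /andP[e_gt0 lt_er].
have r_neq0 : r%:R != 0 :> R by rewrite pnatr_eq0 -lt0n (leq_trans _ lt_er).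
have N_gt0 : (0 < 2 * k)%N by rewrite (leq_ltn_trans _ (ltn_ord g)).
have nat_inj : injective (GRing.natmul 1 : nat -> R).
  by move=> a b /eqP; rewrite eqr_nat => /eqP.
set u := k%:R - e%:R / r%:R.
(* The point is not a node, because r does not divide e. *)
have u_ne : u - g%:R != 0.
  apply/eqP => u_eq.
  have /eqP : (r * k)%:R = (r * g + e)%:R :> R.
    have -> : (r * g + e)%:R = (r * k)%:R - r%:R * (u - g%:R) :> R.
      by rewrite /u natrD !natrM; field.
    by rewrite u_eq mulr0 subr0.
  rewrite eqr_nat => /eqP rkE.
  have : (r %| e)%N by rewrite -(dvdn_addr _ (dvdn_mulr g (dvdnn r))) -rkE dvdn_mulr.
  by move/(dvdn_leq e_gt0); rewrite leqNgt lt_er.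
have poch : pochhammer (- k%:R + 1 - e%:R / r%:R) (2 * k) =
    (u - g%:R) * \prod_(j < 2 * k | j != g) (u - j%:R).
  transitivity (\prod_(j < 2 * k) (u - j%:R)); last by rewrite (bigD1 g).
  rewrite /pochhammer (reindex_inj rev_ord_inj) /=.
  apply: eq_bigr => j _; rewrite natrB // -natr1 natrM /u; ring.
rewrite lagrangeE // hornerM hornerC !horner_prod /dd_coef poch.
under [X in _ = _ * X]eq_bigr => j _ do rewrite hornerXsubC.
under [X in _ = X^-1 * _]eq_bigr => j _ do rewrite hornerXsubC.
set Pu := \prod_(j < 2 * k | j != g) (u - j%:R).
have -> : \prod_(j < 2 * k | j != g) (g%:R - j%:R : R)
   = (-1) ^+ (2 * k - g.+1) * (g`! * (2 * k - g.+1)`!)%:R.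
  rewrite -prod_node_differences.
  by rewrite subnKC.
have expE : k%:Z - (g : nat)%:Z + k%:Z = ((2 * k - g.+1).+1)%:Z.
  by have := ltn_ord g; lia.
have absE : absz (k%:Z - (k%:Z - (g : nat)%:Z))%R = g by lia.
have binE : 'C(2 * k - 1, g)%:R
    = (2 * k - 1)`!%:R / (g`! * (2 * k - g.+1)`!)%:R :> R.
  have le_g : (g <= 2 * k - 1)%N by have := ltn_ord g; lia.
  have -> : (2 * k - g.+1 = 2 * k - 1 - g)%N by lia.
  by rewrite -(bin_fact le_g) [X in _ = X / _]natrM mulfK // pnatr_eq0 muln_eq0 -!lt0n !fact_gt0.
rewrite expE absE binE -exprnP exprS intrB -!pmulrn.
set s : R := (-1) ^+ _; have sV : s^-1 = s by rewrite invr_sign.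
have -> : e%:R / r%:R - (k%:R - g%:R) = - (u - g%:R) by rewrite /u; ring.
rewrite [(s * _)^-1]invfM sV; field.
by rewrite u_ne !pnatr_eq0 -!lt0n !fact_gt0.
Qed.

Lemma dd_symbol_lagrange (R : realType) r k (z : R[i]) : z != 0 -> (0 < r)%N ->
  z ^+ (r * k) * dd_symbol r k z = z ^+ (r * k) +
    \sum_(1 <= e < r) \sum_(g < 2 * k)
      ((tnth (lagrange (2 * k) (GRing.natmul 1)) g).[k%:R - e%:R / r%:R])%:C%C
        * z ^+ (r * g + e).
Proof.
move=> z_neq0 r_gt0; rewrite /dd_symbol mulrDr mulr1; congr (_ + _).
rewrite mulr_sumr; apply: eq_big_nat => e e_range.
rewrite mulr_sumr (reindex_inj rev_ord_inj) /=; apply: eq_bigr => g _.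
have -> : (2 * k - g.+1)%N%:Z - k%:Z + 1 = k%:Z - (g : nat)%:Z.
  by have := ltn_ord g; lia.
rewrite dd_coef_lagrange // mulrCA; congr (_ * _).
rewrite !exprnP -expfzDr //; congr (_ ^ _).
by rewrite !PoszD !PoszM; ring.
Qed.

(** Both zeta and w have modulus 1, so multiplying by (zeta * w) ^+ (r * k)
    turns the Laurent polynomial into a polynomial without changing moduli;
    the residue class e then carries the factor zeta ^+ e. *)
Lemma dd_symbol_near_root_of_unity (R : realType) r k (zeta : R[i]) :
    (0 < r)%N -> zeta ^+ r = 1 ->
  exists2 K : R[i], 0 <= K & forall w : R[i], `|w| = 1 ->
    `|dd_symbol r k (zeta * w) - \sum_(e < r) zeta ^+ e|
      <= K * `|w - 1| ^+ (2 * k).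
Proof.
move=> r_gt0 zeta_r.
have zeta_neq0 : zeta != 0.
  by apply: contra_eq_neq zeta_r => ->; rewrite expr0n gtn_eqF // eq_sym oner_eq0.
have zeta1 : `|zeta| = 1.
  by apply/eqP; rewrite -(@eqrXn2 _ r) // -normrX zeta_r expr1n normr1.
pose c e (g : 'I_(2 * k)) : R[i] :=
  ((tnth (lagrange (2 * k) (GRing.natmul 1)) g).[k%:R - e%:R / r%:R])%:C%C.
have /choice[K KP] : forall e, exists K : R[i], 0 <= K /\
    forall w : R[i], `|w| = 1 ->
      `|\sum_g c e g * w ^+ (r * g + e) - w ^+ (r * k)|
        <= K * `|w - 1| ^+ (2 * k).
  move=> e.
  have [|K K_ge0 KP] := @unit_circle_bound_of_moments R[i] _ (c e)
    (fun g => r * g + e)%N (r * k) (2 * k); last by exists K.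
  move=> i lt_i; rewrite -(rmorph_nat (real_complex R)).
  rewrite -(lagrange_bin_reproduction R e r_gt0 lt_i) rmorph_sum.
  by apply: eq_bigr => g _; rewrite rmorphM rmorph_nat.
exists (\sum_(1 <= e < r) K e) => [|w w1].
  by apply: sumr_ge0 => e _; case: (KP e).
have w_neq0 : w != 0 by rewrite -normr_eq0 w1 oner_eq0.
have -> : `|dd_symbol r k (zeta * w) - \sum_(e < r) zeta ^+ e| =
    `|\sum_(1 <= e < r) zeta ^+ e *
       (\sum_g c e g * w ^+ (r * g + e) - w ^+ (r * k))|.
  rewrite -[LHS]mul1r -[X in X * _](_ : `|(zeta * w) ^+ (r * k)| = 1); last first.
    by rewrite normrX normrM zeta1 w1 mulr1 expr1n.
  rewrite -normrM mulrBr dd_symbol_lagrange ?mulf_neq0 //.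
  have zeta_rX j : zeta ^+ (r * j) = 1 by rewrite exprM zeta_r expr1n.
  congr `|_|; rewrite exprMn zeta_rX mul1r.
  rewrite -(big_mkord xpredT (fun e => zeta ^+ e)) (big_ltn r_gt0) expr0.
  rewrite mulrDr mulr1 opprD addrACA subrr add0r mulr_sumr -sumrB.
  apply: eq_bigr => e _; rewrite mulrBr mulr_sumr [w ^+ _ * _]mulrC.
  congr (_ - _); apply: eq_bigr => g _.
  by rewrite exprMn exprD zeta_rX mul1r mulrCA.
rewrite mulr_suml (le_trans (ler_norm_sum _ _ _)) //.
apply: ler_sum => e _; rewrite normrM normrX zeta1 expr1n mul1r.
by case: (KP e) => _; apply.
Qed.

(** * Points of the unit circle *)

Lemma normr_sin_le (R : realType) (x : R) : `|sin x| <= `|x|.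
Proof.
have sinle y : 0 <= y -> `|sin y| <= y :> R.
  move=> y_ge0; have [|c _] := @MVT_segment R sin cos 0 y y_ge0 _ _.
    exact/continuous_subspaceT/continuous_sin.
  rewrite sin0 !subr0 => ->; rewrite normrM (ger0_norm y_ge0).
  by rewrite -{2}[y]mul1r ler_wpM2r // cos_max.
have [x_ge0|x_lt0] := leP 0 x; first by rewrite (ger0_norm x_ge0) sinle.
by rewrite -normrN -sinN (le_trans (sinle _ _)) ?oppr_ge0 ?ltr0_norm // ltW.
Qed.

Definition cis (R : realType) (t : R) : R[i] := (cos t +i* sin t)%C.

Lemma cisD (R : realType) (s t : R) : cis (s + t) = cis s * cis t.
Proof.
rewrite /cis cosD sinD; apply/eqP; rewrite eq_complex /= eqxx /=.
by rewrite addrC.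
Qed.

Lemma cis0 (R : realType) : cis (0 : R) = 1.
Proof. by rewrite /cis cos0 sin0. Qed.

Lemma cisX (R : realType) (t : R) n : cis (n%:R * t) = cis t ^+ n.
Proof.
elim: n => [|n IHn]; first by rewrite mul0r cis0.
by rewrite -natr1 mulrDl mul1r cisD IHn exprSr.
Qed.

Lemma norm_cis (R : realType) (t : R) : `|cis t| = 1.
Proof. by rewrite normc_def /= cos2Dsin2 sqrtr1. Qed.

Lemma cexp_cis (R : realType) (t : R) : cexp (- ('i%C * t%:C%C)) = cis (- t).
Proof.
have -> : - ('i%C * t%:C%C) = (0 +i* - t)%C by simpc.
by rewrite /cexp /= expR0 mul1r.
Qed.

(** The chord is at most the arc: the squared chord is (2 * sin (t / 2)) ^+ 2. *)
Lemma norm_cisB1_le (R : realType) (t : R) : `|cis t - 1| <= `|t|%:C%C.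
Proof.
rewrite normc_def /= oppr0 addr0 lecR -[leRHS]sqrtr_sqr ler_wsqrtr //.
have tE : t = (t / 2) *+ 2 by rewrite -[RHS]mulr_natr divfK // pnatr_eq0.
have -> : (cos t - 1) ^+ 2 + sin t ^+ 2 = (2 * sin (t / 2)) ^+ 2.
  rewrite exprMn !sin2cos2.
  by rewrite {1 2}tE cos_mulr2n -mulr_natl; ring.
rewrite -[leLHS]real_normK ?num_real // -[leRHS]real_normK ?num_real //.
rewrite lerXn2r ?nnegrE // normrM ger0_norm //.
have -> : `|t| = 2 * `|t / 2| by rewrite normrM normfV (@ger0_norm _ 2) //; field.
by rewrite ler_wpM2l // normr_sin_le.
Qed.

Lemma cis_root_of_unity (R : realType) r j : (0 < r)%N ->
  cis (- (2 * pi * (j%:R / r%:R)) : R) ^+ r = 1.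
Proof.
move=> r_gt0; rewrite -cisX.
have -> : r%:R * - (2 * pi * (j%:R / r%:R)) = j%:R * - (pi *+ 2) :> R.
  by field; rewrite pnatr_eq0 -lt0n.
by rewrite cisX /cis cosN sinN cos2pi sin2pi oppr0 expr1n.
Qed.

Lemma cis_neq1 (R : realType) r j : (0 < j < r)%N ->
  cis (- (2 * pi * (j%:R / r%:R)) : R) != 1.
Proof.
move=> /andP[j_gt0 lt_jr].
have r_gt0 : 0 < r%:R :> R by rewrite ltr0n (leq_ltn_trans _ lt_jr).
have t_gt0 : 0 < (pi : R) * (j%:R / r%:R) < pi.
  rewrite mulr_gt0 ?pi_gt0 ?divr_gt0 ?(ltr0n _ j) //=.
  by rewrite -[ltRHS]mulr1 ltr_pM2l ?pi_gt0 // ltr_pdivrMr // mul1r ltr_nat.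
have : cos (2 * pi * (j%:R / r%:R)) < 1 :> R.
  rewrite -mulrA mulr_natl cos_mulr2n cos2sin2.
  have s_gt0 := sin_gt0_pi t_gt0.
  have := @exprn_gt0 _ 2 _ s_gt0.
  by rewrite -mulr_natl; lra.
by rewrite /cis cosN eq_complex /= => /lt_eqF ->.
Qed.

Lemma sum_unity_powers (F : idomainType) r (zeta : F) :
  zeta ^+ r = 1 -> zeta != 1 -> \sum_(e < r) zeta ^+ e = 0.
Proof.
move=> zeta_r zeta_neq1; apply: (mulfI (_ : zeta - 1 != 0)).
  by rewrite subr_eq0.
by rewrite -subrX1 zeta_r subrr mulr0.
Qed.

(** * Orders of vanishing at the origin of the plane *)

(** A bound on the fixed disc enorm x <= 1 in place of a neighbourhood: the
    constants then combine without shrinking the domain. *)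
Definition order_ge (R : realType) (f : R * R -> R[i]) (N : nat) :=
  exists2 C : R, 0 <= C &
    forall x, enorm x <= 1 -> `|f x| <= (C * enorm x ^+ N)%:C%C.

Lemma enorm_ge0 (R : realType) (x : R * R) : 0 <= enorm x.
Proof. exact: sqrtr_ge0. Qed.

Lemma norm_fst_le (R : realType) (x : R * R) : `|x.1| <= enorm x.
Proof. by rewrite -sqrtr_sqr ler_wsqrtr // lerDl sqr_ge0. Qed.

Lemma norm_snd_le (R : realType) (x : R * R) : `|x.2| <= enorm x.
Proof. by rewrite -sqrtr_sqr ler_wsqrtr // lerDr sqr_ge0. Qed.

Lemma eq_order_ge (R : realType) (f g : R * R -> R[i]) N :
  f =1 g -> order_ge f N -> order_ge g N.
Proof. by move=> fg [C C0 fC]; exists C => // x /fC; rewrite fg. Qed.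

Lemma order_ge_leq (R : realType) (f : R * R -> R[i]) M N :
  (M <= N)%N -> order_ge f N -> order_ge f M.
Proof.
move=> le_MN [C C_ge0 fC]; exists C => // x x_le1.
rewrite (le_trans (fC x x_le1)) // lecR ler_wpM2l //.
by rewrite ler_wiXn2l ?enorm_ge0.
Qed.

Lemma order_geD (R : realType) (f g : R * R -> R[i]) N :
  order_ge f N -> order_ge g N -> order_ge (fun x => f x + g x) N.
Proof.
move=> [C C_ge0 fC] [D D_ge0 gD]; exists (C + D) => [|x x_le1].
  exact: addr_ge0.
rewrite (le_trans (ler_normD _ _)) // mulrDl rmorphD.
by rewrite lerD ?fC ?gD.
Qed.

Lemma order_geM (R : realType) (f g : R * R -> R[i]) M N :
  order_ge f M -> order_ge g N -> order_ge (fun x => f x * g x) (M + N).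
Proof.
move=> [C C_ge0 fC] [D D_ge0 gD]; exists (C * D) => [|x x_le1].
  exact: mulr_ge0.
by rewrite normrM exprD mulrACA rmorphM ler_pM ?fC ?gD.
Qed.

Lemma order_ge_cst (R : realType) (c : R[i]) : order_ge (fun => c) 0.
Proof.
exists (complex.Re `|c|) => [|x _].
  by have := normr_ge0 c; rewrite lecE => /andP[].
by rewrite expr0 mulr1 RRe_real // ger0_real.
Qed.

Lemma order_geZ (R : realType) (c : R[i]) (f : R * R -> R[i]) N :
  order_ge f N -> order_ge (fun x => c * f x) N.
Proof. by move=> fN; rewrite -[N]add0n; apply: order_geM => //; apply: order_ge_cst. Qed.

Lemma order_geB (R : realType) (f g : R * R -> R[i]) N :
  order_ge f N -> order_ge g N -> order_ge (fun x => f x - g x) N.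
Proof.
move=> fN gN; apply: order_geD => //.
by apply: eq_order_ge (order_geZ (-1) gN) => x; rewrite mulN1r.
Qed.

Lemma order_ge_sum (R : realType) n (f : nat -> R * R -> R[i]) N :
    (forall k, (k < n)%N -> order_ge (f k) N) ->
  order_ge (fun x => \sum_(0 <= k < n) f k x) N.
Proof.
elim: n => [|n IHn] fN.
  exists 0 => // x _; by rewrite big_geq // normr0 mul0r.
apply: (@eq_order_ge _ (fun x => \sum_(0 <= k < n) f k x + f n x)).
  by move=> x; rewrite big_nat_recr.
by apply: order_geD; [apply: IHn => k /ltnW; apply: fN | apply: fN].
Qed.

(** Where the denominator is 0 the quotient is 0, so that the bound C holds on
    the whole disc. *)
Lemma limsup_at0_lty (R : realType) (f : R * R -> R[i]) M N :
    (M <= N)%N -> order_ge f N ->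
  (limsup_at0 (fun x => (cmodulus (f x) / enorm x ^+ M)%R) < +oo)%E.
Proof.
move=> le_MN /(order_ge_leq le_MN)[C C_ge0 fC].
rewrite /limsup_at0 limf_esupE; apply: (@le_lt_trans _ _ C%:E); last exact: ltry.
pose V := [set x : R * R | enorm x <= 1]%classic.
have V_nbhs : dnbhs (0 : R * R) V.
  apply: nbhs_dnbhs; apply/nbhs_ballP; exists (1 / 2) => //= x [/= x1 x2].
  move: x1 x2; rewrite -!ball_normE /= !sub0r !normrN !ltr_norml.
  move=> /andP[? ?] /andP[? ?]; rewrite /V /= -[leRHS]sqrtr1 ler_wsqrtr //.
  by nra.
apply: (@le_trans _ _
    (ereal_sup [set (cmodulus (f x) / enorm x ^+ M)%:E | x in V]%classic)).
  by apply: ereal_inf_lbound; exists V; first exact: V_nbhs.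
apply: ge_ereal_sup => _ [x /= x_le1 <-]; rewrite lee_fin.
have : cmodulus (f x) <= C * enorm x ^+ M.
  by have := fC x x_le1; rewrite lecE => /andP[].
have [->|x_neq0] := eqVneq (enorm x ^+ M) 0; first by move=> _; rewrite invr0 mulr0.
by rewrite ler_pdivrMr // lt_neqAle eq_sym x_neq0 exprn_ge0 // enorm_ge0.
Qed.
(** * The anisotropic symbol *)

(** Taking the products apart, each of the sums of alpha * beta, of
    alpha * b k and of beta * a k has one more term in the first sum than in
    the second, with the top index n for b and for a. *)
Lemma sum_aniso_telescope (K : comPzRingType) (alpha beta : K) (a b : nat -> K) n :
    (0 < n)%N ->
  \sum_(0 <= k < n) (alpha + a (n - k)%N) * (beta + b k.+1)
    - \sum_(0 <= k < n.-1) (alpha + a (n - k - 1)%N) * (beta + b k.+1)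
  = alpha * beta + alpha * b n + beta * a n
    + (\sum_(0 <= k < n) a (n - k)%N * b k.+1
       - \sum_(0 <= k < n.-1) a (n - k - 1)%N * b k.+1).
Proof.
have expand p : \sum_(0 <= k < p) (alpha + a (p - k)%N) * (beta + b k.+1)
    = p%:R * (alpha * beta) + alpha * (\sum_(0 <= k < p) b k.+1)
      + beta * (\sum_(0 <= k < p) a k.+1)
      + \sum_(0 <= k < p) a (p - k)%N * b k.+1.
  have -> : \sum_(0 <= k < p) a k.+1 = \sum_(0 <= k < p) a (p - k)%N.
    rewrite big_nat_rev; apply: eq_big_nat => k /andP[_ lt_kp].
    by rewrite add0n subnSK.
  have -> : p%:R * (alpha * beta) = \sum_(0 <= k < p) alpha * beta.
    by rewrite big_const_nat iter_addr_0 subn0 mulr_natl.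
  rewrite !mulr_sumr -!big_split; apply: eq_bigr => k _ /=; ring.
case: n => // n _; rewrite [n.+1.-1]/=.
have shift (F : K -> nat -> K) : \sum_(0 <= k < n) F (a (n.+1 - k - 1)%N) k
    = \sum_(0 <= k < n) F (a (n - k)%N) k.
  by apply: eq_big_nat => k /andP[_ lt_kn]; rewrite subnAC subn1.
rewrite (shift (fun x k => (alpha + x) * (beta + b k.+1))).
rewrite (shift (fun x k => x * b k.+1)) !expand.
rewrite !(big_nat_recr n 0 (fun k => b k.+1)) //.
rewrite !(big_nat_recr n 0 (fun k => a k.+1)) //= -natr1; ring.
Qed.

(** Here pr stands for one of the coordinates. *)
Lemma order_ge_dd_symbol (R : realType) r k (t : R) (pr : R * R -> R) :
    (0 < r)%N -> cis t ^+ r = 1 -> (forall x, `|pr x| <= enorm x) ->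
  order_ge (fun x => dd_symbol r k (cis t * cis (- pr x))
                     - \sum_(e < r) cis t ^+ e) (2 * k).
Proof.
move=> r_gt0 zeta_r pr_le.
have [K K_ge0 KP] := dd_symbol_near_root_of_unity k r_gt0 zeta_r.
exists (complex.Re K) => [|x _]; first by move: K_ge0; rewrite lecE => /andP[].
rewrite (le_trans (KP _ (norm_cis _))) // rmorphM rmorphXn /=.
rewrite RRe_real ?ger0_real // ler_wpM2l // lerXn2r ?nnegrE //.
  by rewrite ler0c enorm_ge0.
by rewrite (le_trans (norm_cisB1_le _)) // normrN lecR pr_le.
Qed.

(** The point of the grid is represented by its two roots of unity, which
    treats the origin and the other points at once. *)
Lemma order_ge_aniso_hat (R : realType) m n (y : R * R) :
    (0 < m)%N -> (0 < n)%N ->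
  let zeta1 := cis (- (2 * pi * y.1)) in let zeta2 := cis (- (2 * pi * y.2)) in
    zeta1 ^+ 2 = 1 -> zeta2 ^+ m = 1 ->
  order_ge (fun x => aniso_hat m n (x.1 + 2 * pi * y.1, x.2 + 2 * pi * y.2)
              - (\sum_(e < 2) zeta1 ^+ e) * (\sum_(e < m) zeta2 ^+ e)) (2 * n).
Proof.
move=> m_gt0 n_gt0 zeta1 zeta2 zeta1_2 zeta2_m.
set alpha := \sum_(e < 2) _; set beta := \sum_(e < m) _.
pose a k (x : R * R) := dd_symbol 2 k (zeta1 * cis (- x.1)) - alpha.
pose b k (x : R * R) := dd_symbol m k (zeta2 * cis (- x.2)) - beta.
have aP k : order_ge (a k) (2 * k).
  exact: order_ge_dd_symbol zeta1_2 (@norm_fst_le R).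
have bP k : order_ge (b k) (2 * k).
  exact: order_ge_dd_symbol zeta2_m (@norm_snd_le R).
apply: (@eq_order_ge _ (fun x => alpha * b n x + beta * a n x
    + (\sum_(0 <= k < n) a (n - k)%N x * b k.+1 x
       - \sum_(0 <= k < n.-1) a (n - k - 1)%N x * b k.+1 x))).
  move=> x; rewrite /aniso_hat /aniso_symbol !cexp_cis /= !opprD !cisD.
  rewrite ![cis (- x.1) * _]mulrC ![cis (- x.2) * _]mulrC -/zeta1 -/zeta2.
  have aE k : alpha + a k x = dd_symbol 2 k (zeta1 * cis (- x.1)).
    by rewrite addrC subrK.
  have bE k : beta + b k x = dd_symbol m k (zeta2 * cis (- x.2)).
    by rewrite addrC subrK.
  have /= := sum_aniso_telescope alpha beta (a^~ x) (b^~ x) n_gt0.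
  under eq_bigr => k _ do rewrite aE bE.
  under [X in _ - X]eq_bigr => k _ do rewrite aE bE.
  by move=> ->; ring.
apply: order_geD.
  by apply: order_geD; apply: order_geZ.
apply: order_geB; apply: order_ge_sum => k lt_kn.
  apply: order_ge_leq (order_geM (aP _) (bP _)); lia.
apply: order_ge_leq (order_geM (aP _) (bP _)); lia.
Qed.

Theorem proposition5p2 (R : realType) (m q n : nat)
    (hm : (3 <= m)%N) (hodd : odd m)
    (hq : (1 <= q)%N) (hn : (1 <= n)%N) (hqn : (q <= n)%N) :
  (forall y : R * R,
     y <> (0, 0) ->
     (y.1 = 0 \/ y.1 = 1 / 2%:R) ->
     (exists2 j : nat, (j < m)%N & y.2 = j%:R / m%:R) ->
     (limsup_at0 (fun x : R * R =>
        (cmodulus (aniso_hat m n (x.1 + 2%:R * pi * y.1,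
                                  x.2 + 2%:R * pi * y.2))
           / enorm x ^+ (2 * q))%R) < +oo)%E)
  /\
  (limsup_at0 (fun x : R * R =>
     (cmodulus (aniso_hat m n x - (2 * m)%:R) / enorm x)%R) < +oo)%E.
Proof.
have m_gt0 : (0 < m)%N by apply: leq_trans hm.
split=> [y y_neq0 y1P [j lt_jm y2E]|].
- have [i lt_i2 y1E] : exists2 i, (i < 2)%N & y.1 = i%:R / 2%:R.
    by case: y1P => ->; [exists 0%N; rewrite // mul0r | exists 1%N].
  apply: (@limsup_at0_lty _ _ _ (2 * n)); first by rewrite leq_mul2l.
  have zeta1_2 : cis (- (2 * pi * y.1)) ^+ 2 = 1.
    by rewrite y1E cis_root_of_unity.
  have zeta2_m : cis (- (2 * pi * y.2)) ^+ m = 1.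
    by rewrite y2E cis_root_of_unity.
  apply: eq_order_ge (order_ge_aniso_hat m_gt0 hn zeta1_2 zeta2_m) => x /=.
  have [i0|i_gt0] := posnP i; last first.
    by rewrite (sum_unity_powers zeta1_2) ?mul0r ?subr0 // y1E cis_neq1 ?i_gt0.
  have [j0|j_gt0] := posnP j; last first.
    by rewrite (sum_unity_powers zeta2_m) ?mulr0 ?subr0 // y2E cis_neq1 ?j_gt0.
  by case: y_neq0; rewrite [y]surjective_pairing y1E y2E i0 j0 !mul0r.
- have cis00 : cis (- (2 * pi * 0)) = 1 :> R[i] by rewrite mulr0 oppr0 cis0.
  have := @order_ge_aniso_hat R m n (0, 0) m_gt0 hn.
  rewrite /= cis00 !expr1n => /(_ erefl erefl) vanish.
  under eq_fun => x do rewrite -[enorm x]expr1.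
  apply: (@limsup_at0_lty _ _ _ (2 * n)); first by rewrite (leq_trans hn) // leq_pmull.
  apply: eq_order_ge vanish => -[x1 x2] /=.
  have ones r : \sum_(e < r) 1 ^+ e = r%:R :> R[i].
    by under eq_bigr do rewrite expr1n; rewrite sumr_const card_ord.
  by rewrite !ones !mulr0 !addr0 natrM.
Qed.
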